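(* Let $d\ge1$ and let $C,\mu>0$. There is a constant $C_{\mu,d}>0$ (depending only on $\mu$, $d$ and $C$) such that the following holds for every $n\ge1$. Let $X=\{x_1,\dots,x_n\}\subset\mathbb{Z}^d$ and $Y=\{y_1,\dots,y_n\}\subset\mathbb{Z}^d$ each consist of $n$ distinct points, and let $M=(m_{jk})_{1\le j,k\le n}$ be a complex matrix with $$|m_{jk}|\le C e^{-\mu|x_j-y_k|}\qquad(1\le j,k\le n).$$ Then $$\sum_{\pi\in S_n}\prod_{j=1}^n|m_{j\,\pi(j)}|\le C_{\mu,d}^n\,e^{-\frac{\mu}{2\sqrt d}D_s(X,Y)}.$$
   Context: $|x-y|$ is the Euclidean distance on $\mathbb{Z}^d$, $S_n$ is the symmetric group, and $D_s(X,Y):=\min_{\pi\in S_n}\sum_{j=1}^n|x_j-y_{\pi(j)}|$. *)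

(* Defs.v *)
From HB Require Import structures.
From mathcomp Require Import all_boot all_order all_algebra all_fingroup.
From mathcomp Require Import reals.

Set Implicit Arguments.
Unset Strict Implicit.
Unset Printing Implicit Defensive.

Import Order.TTheory GRing.Theory Num.Theory.

Local Open Scope ring_scope.

(* A point of Z^d is a row vector of integers; an enumerated set of n distinct
   points is an injective family 'I_n -> 'rV[int]_d. *)

Definition edist (R : realType) (d : nat) (x y : 'rV[int]_d) : R :=
  Num.sqrt (\sum_(i < d) ((x 0 i - y 0 i)%:~R) ^+ 2).

Definition match_cost (R : realType) (d n : nat) (X Y : 'I_n -> 'rV[int]_d)
    (s : 'S_n) : R :=
  \sum_(j < n) edist R (X j) (Y (s j)).

(* The minimum of match_cost over the (nonempty) group 'S_n; the default value
   of the iterated minimum is itself one of the values, namely at s = 1. *)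
Definition Ds (R : realType) (d n : nat) (X Y : 'I_n -> 'rV[int]_d) : R :=
  \big[Num.min/match_cost R X Y 1%g]_(s : 'S_n) match_cost R X Y s.

(* Main.v *)
(** Half of the exponential weight is spent on the distance [Ds], which bounds
    the cost of every permutation from below; the sum over permutations of the
    remaining weights is at most the product over rows of the row sums, and
    each row sum is dominated by [\sum_(z in Z^d) e^(- mu |z| / 2)], which is
    compared with a product of [d] geometric series via
    [d |z| >= |z_1| + ... + |z_d|].  The rate obtained this way is [mu / 2],
    which is at least the required [mu / (2 sqrt d)]. *)
Require Import Defs.
From HB Require Import structures.
From mathcomp Require Import all_boot all_order all_algebra all_fingroup.
From mathcomp Require Import complex.
From mathcomp Require Import reals sequences exp.

Set Implicit Arguments.
Unset Strict Implicit.
Unset Printing Implicit Defensive.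

Import Order.TTheory GRing.Theory Num.Theory.

Local Open Scope ring_scope.
Local Open Scope complex_scope.

Lemma ler_sum_inj (R : numDomainType) (I J : finType) (g : I -> J) (F : J -> R) :
  injective g -> (forall j, 0 <= F j) -> \sum_i F (g i) <= \sum_j F j.
Proof.
move=> gI F0.
have -> : \sum_i F (g i) = \sum_(j in [set g i | i in I]) F j.
  by rewrite big_imset //= => x y _ _; apply: gI.
rewrite [leRHS](bigID [in [set g i | i in I]]) /= lerDl.
by apply: sumr_ge0.
Qed.

(** Expanding the product of row sums gives one nonnegative term for every map ['I_n -> 'I_n]; the
    permutations are some of these maps. *)
Lemma permanent_le_prod_row_sums (R : numDomainType) (n : nat)
    (a : 'I_n -> 'I_n -> R) :
  (forall j k, 0 <= a j k) ->
  \sum_(s : 'S_n) \prod_j a j (s j) <= \prod_j \sum_k a j k.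
Proof.
move=> a0; rewrite bigA_distr_bigA /=.
pose F (f : {ffun 'I_n -> 'I_n}) := \prod_j a j (f j).
have F0 f : 0 <= F f by apply: prodr_ge0.
apply: le_trans (ler_sum_inj (@val_inj _ _ 'S_n) F0).
apply: ler_sum => s _; rewrite /F /= [leRHS](eq_bigr (fun j => a j (s j))) //.
by move=> j _; rewrite pvalE.
Qed.

Lemma geometric_sum_le (R : realFieldType) (q : R) (n : nat) :
  0 <= q -> q < 1 -> \sum_(i < n) q ^+ i <= (1 - q)^-1.
Proof.
move=> q0 q1; have q1' : 0 < 1 - q by rewrite subr_gt0.
(* Multiplied by [1 - q], the sum telescopes to [1 - q ^+ n]. *)
rewrite -[leRHS]mul1r ler_pdivlMr // mulrC -opprB mulNr -subrX1 opprB.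
by rewrite gerBl exprn_ge0.
Qed.

(** A finite family lies in a box, and the sum over the box factors into [d] one-dimensional sums.
    Each coordinate is coded by its sign and absolute value, so the factor 2 counts the signs, with
    zero counted twice. *)
Lemma lattice_geometric_sum_le (R : realFieldType) (I : finType) (d : nat)
    (Z : I -> 'rV[int]_d) (q : R) :
  injective Z -> 0 <= q -> q < 1 ->
  \sum_k \prod_(i < d) q ^+ `|Z k 0%R i|%N <= (2 / (1 - q)) ^+ d.
Proof.
move=> ZI q0 q1.
pose N := \max_k \max_(i < d) `|Z k 0%R i|%N.
have ZN k i : (`|Z k 0%R i| < N.+1)%N.
  rewrite ltnS; apply: leq_trans (leq_bigmax k).
  exact: (leq_bigmax (F := fun i => `|Z k 0%R i|%N)).
pose enc k : {ffun 'I_d -> bool * 'I_N.+1} :=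
  [ffun i => (Z k 0 i < 0, inord `|Z k 0%R i|%N)].
have encI : injective enc.
  move=> k l /ffunP kl; apply: ZI; apply/rowP => i.
  have := kl i; rewrite !ffunE => -[sgE /(congr1 val)].
  rewrite /= !inordK // => absE.
  by rewrite [LHS]intEsign [RHS]intEsign sgE absE.
pose F (p : bool * 'I_N.+1) := q ^+ p.2.
rewrite (eq_bigr (fun k => \prod_i F (enc k i))); last first.
  by move=> k _; apply: eq_bigr => i _; rewrite /F ffunE /= inordK.
pose G (f : {ffun 'I_d -> bool * 'I_N.+1}) := \prod_i F (f i).
apply: le_trans (ler_sum_inj (F := G) encI _) _.
  by move=> f; apply: prodr_ge0 => i _; rewrite exprn_ge0.
(* Distributivity read backwards: the sum over all codes is a [d]-th power. *)
rewrite -(bigA_distr_bigA (fun _ => F)) prodr_const card_ord.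
have SF : \sum_p F p = 2 * \sum_(i < N.+1) q ^+ i.
  rewrite /F -(pair_big xpredT xpredT (fun (_ : bool) (i : 'I_N.+1) => q ^+ i)) /=.
  by rewrite big_bool /= mulr_natl mulr2n.
apply: lerXn2r; rewrite ?nnegrE ?SF ?mulr_ge0 ?invr_ge0 ?subr_ge0 ?(ltW q1) //.
  by apply: sumr_ge0 => i _; rewrite exprn_ge0.
by rewrite ler_pM2l ?ltr0n // geometric_sum_le.
Qed.

Lemma le_coord_edist (R : realType) (d : nat) (x y : 'rV[int]_d) (i : 'I_d) :
  (`|x 0%R i - y 0%R i|%N)%:R <= edist R x y.
Proof.
rewrite natr_absz intr_norm -sqrtr_sqr ler_wsqrtr //.
by rewrite (bigD1 i) //= lerDl sumr_ge0 // => k _; rewrite sqr_ge0.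
Qed.

(** The differences [x - Y k] are distinct lattice points. Sharing the rate [a] equally among the
    [d] coordinates gives the ratio [expR (- (a / d%:R))]. *)
Lemma row_sum_le (R : realType) (d n : nat) (a : R) (x : 'rV[int]_d)
    (Y : 'I_n -> 'rV[int]_d) :
  (0 < d)%N -> 0 < a -> injective Y ->
  \sum_k expR (- (a * edist R x (Y k))) <= (2 / (1 - expR (- (a / d%:R)))) ^+ d.
Proof.
move=> d0 a0 YI; have d0' : 0 < d%:R :> R by rewrite ltr0n.
have ZI : injective (fun k => x - Y k) by move=> k l /addrI /oppr_inj /YI.
apply: le_trans (lattice_geometric_sum_le ZI (expR_ge0 _) _); last first.
  by rewrite expR_lt1 oppr_lt0 divr_gt0.
apply: ler_sum => k _.
under eq_bigr do rewrite -expRM_natl.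
rewrite -expR_sum ler_expR.
under eq_bigr do rewrite mulrN.
rewrite sumrN lerN2 -mulr_suml.
(* The distance times [d] is written as a sum of [d] copies, each of which dominates one
   coordinate. *)
rewrite mulrCA ler_pM2l // ler_pdivrMr // mulr_natr -[X in _ *+ X]card_ord.
rewrite -sumr_const; apply: ler_sum => i _.
by rewrite !mxE le_coord_edist.
Qed.

Lemma Ds_le_match_cost (R : realType) (d n : nat) (X Y : 'I_n -> 'rV[int]_d)
    (s : 'S_n) : Ds R X Y <= match_cost R X Y s.
Proof. exact: bigmin_le. Qed.

Lemma Ds_ge0 (R : realType) (d n : nat) (X Y : 'I_n -> 'rV[int]_d) :
  0 <= Ds R X Y.
Proof.
have cost_ge0 s : 0 <= match_cost R X Y s.
  by apply: sumr_ge0 => j _; apply: sqrtr_ge0.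
by apply: le_bigmin.
Qed.

Lemma sum_perm_expR_cost_le (R : realType) (d n : nat) (mu : R)
    (X Y : 'I_n -> 'rV[int]_d) :
  (0 < d)%N -> 0 < mu -> injective Y ->
  \sum_(s : 'S_n) expR (- (mu * match_cost R X Y s)) <=
  ((2 / (1 - expR (- (mu / 2 / d%:R)))) ^+ d) ^+ n *
    expR (- (mu / 2 * Ds R X Y)).
Proof.
move=> d0 mu0 YI; have mu2 : 0 < mu / 2 by rewrite divr_gt0.
pose a j k := expR (- (mu / 2 * edist R (X j) (Y k))).
(* One half of [mu] goes into the entries [a j k]; the other half stays with the total cost, to be
   bounded through [Ds]. *)
have -> : \sum_(s : 'S_n) expR (- (mu * match_cost R X Y s)) =
    \sum_(s : 'S_n) (\prod_j a j (s j)) * expR (- (mu / 2 * match_cost R X Y s)).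
  apply: eq_bigr => s _.
  rewrite -expR_sum sumrN -mulr_sumr -expRD -opprD -mulrDl.
  by rewrite -splitr.
have a0 j k : 0 <= a j k by apply: expR_ge0.
apply: (@le_trans _ _
    ((\sum_(s : 'S_n) \prod_j a j (s j)) * expR (- (mu / 2 * Ds R X Y)))).
  rewrite mulr_suml; apply: ler_sum => s _.
  rewrite ler_wpM2l ?prodr_ge0 // ler_expR lerN2 ler_pM2l //.
  exact: Ds_le_match_cost.
rewrite ler_wpM2r ?expR_ge0 //.
apply: le_trans (permanent_le_prod_row_sums a0) _.
rewrite -[X in _ ^+ X]card_ord -prodr_const.
apply: ler_prod => j _; rewrite sumr_ge0 //=.
exact: row_sum_le.
Qed.

Theorem theorem1p2 (R : realType) (d : nat) (C mu : R)
    (hd : (1 <= d)%N) (hC : 0 < C) (hmu : 0 < mu) :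
  exists2 K : R, 0 < K &
    forall (n : nat) (X Y : 'I_n -> 'rV[int]_d) (M : 'M[R[i]]_n),
      (1 <= n)%N -> injective X -> injective Y ->
      (forall j k : 'I_n,
         `|M j k| <= (C * expR (- (mu * edist R (X j) (Y k))))%:C) ->
      \sum_(s : 'S_n) \prod_(j < n) `|M j (s j)|
        <= (K ^+ n * expR (- (mu / (2 * Num.sqrt d%:R) * Ds R X Y)))%:C.
Proof.
(* [S] bounds each row sum at rate [mu / 2]; every row also contributes a factor [C]. *)
pose S := (2 / (1 - expR (- (mu / 2 / d%:R)))) ^+ d.
exists (C * S).
  rewrite mulr_gt0 // exprn_gt0 // divr_gt0 // subr_gt0 expR_lt1 oppr_lt0.
  by rewrite !divr_gt0 // ltr0n.
move=> n X Y M _ _ YI hM.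
apply: (@le_trans _ _
    (C ^+ n * \sum_(s : 'S_n) expR (- (mu * match_cost R X Y s)))%:C).
  rewrite mulr_sumr rmorph_sum /=; apply: ler_sum => s _.
  rewrite /match_cost mulr_sumr -sumrN expR_sum -[X in C ^+ X]card_ord.
  rewrite -prodr_const -big_split /= rmorph_prod /=.
  by apply: ler_prod => j _; rewrite normr_ge0 hM.
rewrite lecR exprMn -[leRHS]mulrA ler_pM2l ?exprn_gt0 //.
apply: le_trans (sum_perm_expR_cost_le X hd hmu YI) _.
rewrite ler_wpM2l ?exprn_ge0 ?divr_ge0 ?subr_ge0 ?expR_le1 ?oppr_le0 //.
  by rewrite !divr_ge0 // ltW.
(* Since [Ds] is nonnegative, it remains to compare the rates, which comes down to [Num.sqrt d%:R]
   being at least 1. *)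
rewrite ler_expR lerN2 ler_wpM2r ?Ds_ge0 // ler_pM2l // invfM ler_piMr ?invr_ge0 ?ler0n //.
rewrite invf_le1 ?sqrtr_gt0 ?ltr0n //.
by rewrite -[leLHS]sqrtr1 ler_wsqrtr // ler1n.
Qed.
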